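(* The classes $\mathcal{BDC}$ and $\mathcal{PCF}$ are closed under left quotients by finite sets. That is, if $L\subseteq\Sigma^*$ is in $\mathcal{BDC}$ (respectively $\mathcal{PCF}$) and $K\subseteq\Sigma^*$ is finite, then $K^{-1}L$ is in $\mathcal{BDC}$ (respectively $\mathcal{PCF}$).
   Context: $\Sigma$ is a finite alphabet. $\mathcal{BDC}$ denotes the Boolean closure of the class of deterministic context-free languages: a language over $\Sigma$ is in $\mathcal{BDC}$ if it belongs to the smallest family of subsets of $\Sigma^*$ containing the deterministic context-free languages over $\Sigma$ and closed under finite union, finite intersection and complement. $\mathcal{PCF}$ denotes the class of poly-context-free languages, i.e. intersections of finitely many context-free languages over the same alphabet. For $K,L\subseteq\Sigma^*$, the left quotient of $L$ by $K$ is $K^{-1}L=\{w\in\Sigma^*:\exists u\in K\text{ such that }uw\in L\}$. *)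

(* Defs.v *)
From Stdlib Require Import Relations.Relation_Operators.
From HB Require Import structures.
From mathcomp Require Import all_boot.
From mathcomp Require Import mathcomp_extra boolp classical_sets functions cardinality.

Set Implicit Arguments.
Unset Strict Implicit.
Unset Printing Implicit Defensive.

Local Open Scope classical_set_scope.

Definition language (Sigma : finType) := set (seq Sigma).

(* In a sentential form, [inl] marks nonterminals and [inr] terminals. *)
Record cfg (Sigma : finType) := Cfg {
  nonterminal : finType;
  start : nonterminal;
  productions : seq (nonterminal * seq (nonterminal + Sigma))
}.

Inductive cfg_step (Sigma : finType) (G : cfg Sigma) :
    seq (nonterminal G + Sigma) -> seq (nonterminal G + Sigma) -> Prop :=
| CfgStep l r A rhs : (A, rhs) \in productions G ->
    cfg_step (l ++ inl A :: r) (l ++ rhs ++ r).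

Definition cfg_language (Sigma : finType) (G : cfg Sigma) : language Sigma :=
  [set w | clos_refl_trans_1n _ (@cfg_step Sigma G)
             [:: inl (start G)] (map inr w)].

Definition CFL (Sigma : finType) : set (language Sigma) :=
  [set L | exists G : cfg Sigma, cfg_language G = L].

(* Deterministic pushdown automata with acceptance by final state.
   [delta q (Some a) Z] is the move, if any, that reads the letter [a], and
   [delta q None Z] is the move that reads no letter; [Z] is the top of the
   stack, and a move replaces it by a word whose first letter is the new top. *)
Record dpda (Sigma : finType) := Dpda {
  state : finType;
  stack_symbol : finType;
  delta : state -> option Sigma -> stack_symbol ->
          option (state * seq stack_symbol);
  init_state : state;
  init_stack : stack_symbol;
  final : {set state};
  delta_deterministic : forall q Z,
    delta q None Z != None -> forall a, delta q (Some a) Z = None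
}.

Definition config (Sigma : finType) (M : dpda Sigma) : Type :=
  (state M * seq Sigma * seq (stack_symbol M))%type.

Inductive dpda_step (Sigma : finType) (M : dpda Sigma) :
    config M -> config M -> Prop :=
| DpdaEps q w Z s q' g : delta q None Z = Some (q', g) ->
    dpda_step (q, w, Z :: s) (q', w, g ++ s)
| DpdaRead q a w Z s q' g : delta q (Some a) Z = Some (q', g) ->
    dpda_step (q, a :: w, Z :: s) (q', w, g ++ s).

Definition dpda_language (Sigma : finType) (M : dpda Sigma) : language Sigma :=
  [set w | exists q s, q \in final M /\
     clos_refl_trans_1n _ (@dpda_step Sigma M)
       (init_state M, w, [:: init_stack M]) (q, [::], s)].

Definition DCFL (Sigma : finType) : set (language Sigma) :=
  [set L | exists M : dpda Sigma, dpda_language M = L].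

Definition boolean_closed (Sigma : finType) (F : set (language Sigma)) : Prop :=
  [/\ forall K L, F K -> F L -> F (K `|` L),
      forall K L, F K -> F L -> F (K `&` L) &
      forall L, F L -> F (~` L)].

Definition BDC (Sigma : finType) : set (language Sigma) :=
  smallest (@boolean_closed Sigma) (@DCFL Sigma).

Definition PCF (Sigma : finType) : set (language Sigma) :=
  [set L | exists (n : nat) (C : 'I_n.+1 -> language Sigma),
     (forall i, CFL (C i)) /\ L = \bigcap_i C i].

Definition left_quotient (Sigma : finType) (K L : language Sigma) :
    language Sigma :=
  [set w | exists2 u, K u & L (u ++ w)].

(* Main.v *)
(* Left quotients commute with the Boolean operations and turn unions in [K]
   into unions, and [(a :: u)^-1 L = u^-1 (a^-1 L)], so everything reduces to
   the quotient of a DCFL or CFL by a single letter [a]; for PCF one also uses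
   that [\bigcap_i C i `|` \bigcap_j D j = \bigcap_(i, j) (C i `|` D j)] and
   that CFLs are closed under union.  A DPDA for [a^-1 L] runs a DPDA for [L]
   with a pending letter [a], consumed by a move that reads no input.  A
   grammar for [a^-1 L] adds to each nonterminal [A] a marked copy generating
   [a^-1 L(A)], whose productions delete a nullable prefix of a right-hand side
   of [A] and then delete the letter [a] or mark the next nonterminal. *)
Require Import Defs.
From Stdlib Require Import Relations.Relation_Operators.
From mathcomp Require Import all_boot.
From mathcomp Require Import boolp classical_sets cardinality.

Set Implicit Arguments.
Unset Strict Implicit.
Unset Printing Implicit Defensive.

Local Open Scope classical_set_scope.

(** * Transfer of runs along a map between transition systems *)

Lemma clos_rt1n_map (S T : Type) (R : S -> S -> Prop) (Q : T -> T -> Prop)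
    (f : S -> T) :
  (forall x y, R x y -> Q (f x) (f y)) ->
  forall x y, clos_refl_trans_1n _ R x y ->
    clos_refl_trans_1n _ Q (f x) (f y).
Proof.
move=> RQ x y; elim=> [z|x' y' z Rxy _ IH]; first exact: rt1n_refl.
exact: rt1n_trans (RQ _ _ Rxy) IH.
Qed.

(** A [Q]-step out of an image [f x] lifts to an [R]-step from [x], whose target lies over the
    target of the [Q]-step, so the lifts chain. *)
Lemma clos_rt1n_lift (S T : Type) (R : S -> S -> Prop) (Q : T -> T -> Prop)
    (f : S -> T) :
  (forall x d, Q (f x) d -> exists2 y, R x y & f y = d) ->
  forall x d, clos_refl_trans_1n _ Q (f x) d ->
    exists2 y, clos_refl_trans_1n _ R x y & f y = d.
Proof.
move=> QR x d; move E: (f x) => c Qcd.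
elim: Qcd x E => {c d} [c|c c' d Qc _ IH] x E.
  by exists x => //; exact: rt1n_refl.
move: Qc; rewrite -E => /QR[y Rxy /IH[z Ryz fz]].
by exists z => //; exact: rt1n_trans Rxy Ryz.
Qed.

(** * Letter quotients of deterministic context-free languages *)

Section DpdaQuotient.
Variables (Sigma : finType) (a : Sigma) (M : dpda Sigma).

(* The boolean records whether the pending letter [a] has been consumed. *)
Definition quotient_delta (p : bool * state M) (o : option Sigma)
    (Z : stack_symbol M) : option ((bool * state M) * seq (stack_symbol M)) :=
  let: (b, q) := p in
  if b then omap (fun m => ((true, m.1), m.2)) (delta q o Z)
  else if o is Some _ then None
  else if delta q None Z is Some m then Some ((false, m.1), m.2)
  else omap (fun m => ((true, m.1), m.2)) (delta q (Some a) Z).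

Lemma quotient_delta_deterministic p Z :
  quotient_delta p None Z != None ->
  forall c, quotient_delta p (Some c) Z = None.
Proof.
case: p => -[] q //= H c.
rewrite (@delta_deterministic _ M q Z) //.
by case: (delta q None Z) H.
Qed.

(** A final state must have its flag set: while [a] is pending, the input [a :: w] of [M] has not
    been used up. *)
Definition quotient_dpda : dpda Sigma :=
  Dpda (false, init_state M) (init_stack M) [set p | p.1 & p.2 \in final M]%SET
    quotient_delta_deterministic.

(** The configuration of [M] being simulated. The next two lemmas make this map a bisimulation, so
    runs transfer in both directions. *)
Definition restore_letter (c : config quotient_dpda) : config M :=
  let: (p, w, s) := c in (p.2, if p.1 then w else a :: w, s).

Lemma quotient_dpda_step c d : dpda_step c d ->
  dpda_step (restore_letter c) (restore_letter d).
Proof.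
case=> [[[] q] w Z s [b' q'] g|[[] q] e w Z s [b' q'] g] //=.
- case E: (delta q None Z) => [[q1 g1]|] //= [<- <- <-].
  exact: DpdaEps.
- case E: (delta q None Z) => [[q1 g1]|] //=.
    by case=> <- <- <-; exact: DpdaEps.
  case E': (delta q (Some a) Z) => [[q1 g1]|] //= [<- <- <-].
  exact: DpdaRead.
- case E: (delta q (Some e) Z) => [[q1 g1]|] //= [<- <- <-].
  exact: DpdaRead.
Qed.

Lemma dpda_step_quotient c d : dpda_step (restore_letter c) d ->
  exists2 c', dpda_step c c' & restore_letter c' = d.
Proof.
case: c => [[[b q] w] s]; move E: (restore_letter _) => c0 H.
case: H E => {c0 d} [q0 w0 Z s0 q' g|q0 e w0 Z s0 q' g] /= H [-> Ew Es];
  rewrite Es; case: b Ew => Ew.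
- exists ((true, q'), w, g ++ s0); last by rewrite /= Ew.
  by apply: DpdaEps; rewrite /= H.
- exists ((false, q'), w, g ++ s0); last by rewrite /= Ew.
  by apply: DpdaEps; rewrite /= H.
- rewrite Ew; exists ((true, q'), w0, g ++ s0) => //.
  by apply: DpdaRead; rewrite /= H.
- case: Ew => ? ->; subst e.
  exists ((true, q'), w0, g ++ s0) => //.
  apply: DpdaEps; rewrite /= H.
  (* The pending letter is consumed only where [M] has no move without input; determinism of [M]
     gives this, since it can read [a] here. *)
  case E: (delta q0 None Z) => [m|//].
  by move: H; rewrite delta_deterministic // E.
Qed.

Lemma quotient_dpdaP :
  dpda_language quotient_dpda = left_quotient [set [:: a]] (dpda_language M).
Proof.
apply/seteqP; split=> w.
- move=> [[b q] [s []]]; rewrite inE /= => /andP[-> qf] run.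
  exists [:: a] => //; exists q, s; split=> //.
  exact: (clos_rt1n_map quotient_dpda_step run).
- move=> [_ -> [q [s [qf run]]]].
  (* The restored input at the end of the run is empty, which rules out a letter still pending. *)
  have [[[[[] q'] w'] s'] run' //= [Eq Ew Es]] :=
    clos_rt1n_lift dpda_step_quotient
      (x := ((false, init_state M), w, [:: init_stack M])) run.
  exists (true, q), s; split; first by rewrite inE.
  by move: run'; rewrite Eq Ew Es.
Qed.

End DpdaQuotient.

Lemma DCFL_letter_quotient (Sigma : finType) (a : Sigma) (L : language Sigma) :
  DCFL L -> DCFL (left_quotient [set [:: a]] L).
Proof. by move=> [M <-]; exists (quotient_dpda a M); exact: quotient_dpdaP. Qed.

(** * Leftmost derivations *)

(** Consuming the form from the left leaves no context around the rewritten nonterminal, which suits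
    induction better than [cfg_step]. *)
Inductive leftmost (Sigma : finType) (G : cfg Sigma) :
    seq (nonterminal G + Sigma) -> seq Sigma -> Prop :=
| LeftmostNil : leftmost [::] [::]
| LeftmostRead c x w : leftmost x w -> leftmost (inr c :: x) (c :: w)
| LeftmostExpand A rhs x w : (A, rhs) \in productions G ->
    leftmost (rhs ++ x) w -> leftmost (inl A :: x) w.

Section Leftmost.
Variables (Sigma : finType) (G : cfg Sigma).
Implicit Types (x y : seq (nonterminal G + Sigma)) (u v w : seq Sigma).

Lemma leftmost_cat x y u v :
  leftmost x u -> leftmost y v -> leftmost (x ++ y) (u ++ v).
Proof.
move=> + yv; elim=> [//|c x' w _ IH|A rhs x' w Arhs _ IH] /=.
  exact: LeftmostRead.
by apply: LeftmostExpand Arhs _; rewrite catA.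
Qed.

Lemma leftmost_terminals w : @leftmost _ G (map inr w) w.
Proof. by elim: w => [|c w IH]; [exact: LeftmostNil|exact: LeftmostRead]. Qed.

Lemma cfg_step_catl u x y :
  cfg_step x y -> cfg_step (map inr u ++ x) (map inr u ++ y).
Proof. by case=> l r A rhs H; rewrite 2!(catA (map inr u) l); exact: CfgStep. Qed.

Lemma leftmost_steps x w : leftmost x w ->
  clos_refl_trans_1n _ (@cfg_step Sigma G) x (map inr w).
Proof.
elim=> [|c x' w' _ IH|A rhs x' w' Arhs _ IH].
- exact: rt1n_refl.
- exact: (clos_rt1n_map (cfg_step_catl [:: c]) IH).
- by apply: rt1n_trans IH; exact: (CfgStep [::]).
Qed.

(** Induction on the leftmost derivation: its moves inside [l] are kept, and once [l] is used up the
    expansion of [A] is itself the leftmost move. *)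
Lemma leftmost_contract l r A rhs w : (A, rhs) \in productions G ->
  leftmost (l ++ rhs ++ r) w -> leftmost (l ++ inl A :: r) w.
Proof.
move=> Arhs; move E: (l ++ rhs ++ r) => x xw.
elim: xw l E => [|c x' w' xw IH|B rhs' x' w' Brhs xw IH] [|X l] //= E.
- by apply: LeftmostExpand Arhs _; rewrite E; exact: LeftmostNil.
- by apply: LeftmostExpand Arhs _; rewrite E; exact: LeftmostRead.
- by case: E => -> /IH; exact: LeftmostRead.
- by apply: LeftmostExpand Arhs _; rewrite E; exact: LeftmostExpand Brhs xw.
- case: E => -> El; apply: LeftmostExpand Brhs _.
  by rewrite catA; apply: IH; rewrite -El !catA.
Qed.

(** An arbitrary derivation is absorbed from its last step back to its first by
    [leftmost_contract]. *)
Lemma cfg_languageE w : cfg_language G w <-> leftmost [:: inl (start G)] w.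
Proof.
split; last exact: leftmost_steps.
rewrite /cfg_language /=; move: [:: _] => x.
move E: (map inr w) => y xy; move: E; elim: xy => {x y} [z <-|x y z xy _ IH E].
  exact: leftmost_terminals.
by case: xy (IH E) => l r A rhs; exact: leftmost_contract.
Qed.

End Leftmost.

(** * Closure properties of context-free languages *)

Definition relabel (Sigma N N' : Type) (f : N -> N') (X : N + Sigma) :
    N' + Sigma :=
  match X with inl A => inl (f A) | inr c => inr c end.

(** A derivation from a relabelled form never leaves the image of [f]. This serves the unmarked copy
    in the quotient grammar and both copies in the union grammar. *)
Lemma leftmost_relabel (Sigma : finType) (G G' : cfg Sigma)
    (f : nonterminal G -> nonterminal G') :
  (forall A rhs', (f A, rhs') \in productions G' <->
     exists2 rhs, (A, rhs) \in productions G & rhs' = map (relabel f) rhs) ->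
  forall x w, leftmost (map (relabel f) x) w <-> leftmost x w.
Proof.
move=> fP x w; split.
  move E: (map _ x) => x' x'w.
  elim: x'w x E => {x' w} [|c y w _ IH|A' rhs' y w Arhs _ IH] [|[B|d] x] //=.
  - by move=> _; exact: LeftmostNil.
  - by case=> <- /IH; exact: LeftmostRead.
  - case=> EA Ey; move: Arhs; rewrite -EA => /fP[rhs Brhs Erhs].
    by apply: LeftmostExpand Brhs _; apply: IH; rewrite map_cat Erhs Ey.
elim=> [|c y w' _ IH|A rhs y w' Arhs _ IH] /=.
- exact: LeftmostNil.
- exact: LeftmostRead.
- apply: (@LeftmostExpand _ _ _ (map (relabel f) rhs)).
    by apply/fP; exists rhs.
  by rewrite -map_cat.
Qed.

(** * Grammar for the quotient by a letter *)

Section LetterQuotient.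
Variables (Sigma : finType) (a : Sigma) (G : cfg Sigma).
Let N := nonterminal G.
Let N' : finType := (N * bool)%type.
Let plain : N + Sigma -> N' + Sigma := relabel (fun A => (A, false)).

(* All ways to delete a nullable prefix of [x] and then either delete the
   letter [a] or mark the next nonterminal. *)
Fixpoint form_quotients (x : seq (N + Sigma)) : seq (seq (N' + Sigma)) :=
  match x with
  | [::] => [::]
  | inr c :: x' => if c == a then [:: map plain x'] else [::]
  | inl B :: x' => (inl (B, true) :: map plain x') ::
      (if `[< @leftmost _ G [:: inl B] [::] >] then form_quotients x' else [::])
  end.

Definition quotient_cfg : cfg Sigma :=
  @Cfg Sigma N' (start G, true)
    ([seq ((p.1, false), map plain p.2) | p <- productions G] ++
     [seq ((p.1, true), y) | p <- productions G, y <- form_quotients p.2]).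

Lemma plain_production A rhs' : ((A, false), rhs') \in productions quotient_cfg <->
  exists2 rhs, (A, rhs) \in productions G & rhs' = map plain rhs.
Proof.
rewrite mem_cat; split.
  case/orP=> [/mapP[[B rhs] Brhs [-> ->]]|/allpairsPdep[p [y [_ _ []]]] //].
  by exists rhs.
by move=> [rhs Arhs ->]; apply/orP; left; apply/mapP; exists (A, rhs).
Qed.

Lemma marked_production A y : ((A, true), y) \in productions quotient_cfg <->
  exists2 rhs, (A, rhs) \in productions G & y \in form_quotients rhs.
Proof.
rewrite mem_cat; split.
  case/orP=> [/mapP[p _ []] //|/allpairsPdep[[B rhs] [z [Brhs zq [-> ->]]]]].
  by exists rhs.
move=> [rhs Arhs yq]; apply/orP; right; apply/allpairsPdep.
by exists (A, rhs), y.
Qed.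

Lemma leftmost_plain x w :
  @leftmost _ quotient_cfg (map plain x) w <-> leftmost x w.
Proof. exact: (leftmost_relabel plain_production). Qed.

Lemma form_quotients_catl x y z :
  z \in form_quotients x -> z ++ map plain y \in form_quotients (x ++ y).
Proof.
elim: x z => [|[B|c] x IH] z //=.
- rewrite !inE => /orP[/eqP->|]; first by rewrite /= map_cat eqxx.
  by case: asboolP => // _ /IH ->; rewrite orbT.
- by case: eqP => // _; rewrite !inE => /eqP->; rewrite map_cat.
Qed.

(** Either the deletion stops inside [x], or it passes all of [x], which must then consist of
    nullable nonterminals. *)
Lemma form_quotients_cat x y z : z \in form_quotients (x ++ y) ->
  (exists2 z', z' \in form_quotients x & z = z' ++ map plain y) \/
  (leftmost x [::] /\ z \in form_quotients y).
Proof.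
elim: x z => [|[B|c] x IH] z /=.
- by right; split=> //; exact: LeftmostNil.
- rewrite inE => /orP[/eqP->|].
    left; exists (inl (B, true) :: map plain x); first exact: mem_head.
    by rewrite map_cat.
  case: asboolP => // Bnul /IH[[z' z'x ->]|[xnul zy]].
    by left; exists z' => //; rewrite inE z'x orbT.
  by right; split=> //; exact: leftmost_cat Bnul xnul.
- case: eqP => // _; rewrite inE => /eqP->; left.
  by exists (map plain x); rewrite ?mem_head ?map_cat.
Qed.

Lemma form_quotientsP x z : z \in form_quotients x ->
  exists l r, leftmost l [::] /\
    ((x = l ++ inr a :: r /\ z = map plain r) \/
     (exists2 B, x = l ++ inl B :: r & z = inl (B, true) :: map plain r)).
Proof.
elim: x z => [|[B|c] x IH] z //=.
- rewrite inE => /orP[/eqP->|].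
    exists [::], x; split; first exact: LeftmostNil.
    by right; exists B.
  case: asboolP => // Bnul /IH[l [r [lnul H]]].
  exists (inl B :: l), r; split; first exact: leftmost_cat Bnul lnul.
  by case: H => [[-> ->]|[C -> ->]]; [left|right; exists C].
- case: eqP => // ->; rewrite inE => /eqP->.
  by exists [::], x; split; [exact: LeftmostNil|left].
Qed.

(** When [A] is expanded to [rhs], the deletion either stops inside [rhs], and then [A] gets marked,
    or passes [rhs], and then [A] is nullable and is deleted as well. *)
Lemma leftmost_quotient x w : leftmost x (a :: w) ->
  exists2 y, y \in form_quotients x & @leftmost _ quotient_cfg y w.
Proof.
move E: (a :: w) => v xv; elim: xv E => {x v} [|c x v xv _|A rhs x v Arhs _ IH] //.
  case=> <- ->; exists (map plain x); first by rewrite /= eqxx mem_head.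
  exact/leftmost_plain.
move=> /IH[y /form_quotients_cat[[y' y'rhs ->] yw|[nul yx] yw]].
  exists (inl (A, true) :: map plain x); first exact: mem_head.
  by apply: LeftmostExpand yw; apply/marked_production; exists rhs.
exists y => //=; rewrite inE.
case: asboolP => [_|[]]; first by rewrite yx orbT.
by apply: LeftmostExpand Arhs _; rewrite cats0.
Qed.

Lemma quotient_leftmost x y w : y \in form_quotients x ->
  @leftmost _ quotient_cfg y w -> leftmost x (a :: w).
Proof.
move=> + yw; elim: yw x => {y w} [|c y w yw _|A' rhs' y w Arhs yw IH] x.
- move=> /form_quotientsP[l [r [lnul [[-> Er]|[B _ //]]]]].
  apply: (leftmost_cat lnul); apply: LeftmostRead; apply/leftmost_plain.
  by rewrite -Er; exact: LeftmostNil.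
- move=> /form_quotientsP[l [r [lnul [[-> Er]|[B _ //]]]]].
  apply: (leftmost_cat lnul); apply: LeftmostRead; apply/leftmost_plain.
  by rewrite -Er; exact: LeftmostRead.
- move=> /form_quotientsP[l [r [lnul [[-> Er]|[B -> [EA Er]]]]]];
    apply: (leftmost_cat lnul).
    apply: LeftmostRead; apply/leftmost_plain; rewrite -Er.
    exact: LeftmostExpand Arhs yw.
  (* Expanding the marked [B] picks a quotient of some [rhs]; followed by the plain [r] it is a
     quotient of [rhs ++ r], to which the induction hypothesis applies. *)
  move: Arhs; rewrite EA => /marked_production[rhs Brhs rhs'q].
  apply: LeftmostExpand Brhs _; apply: IH.
  by rewrite Er; exact: form_quotients_catl.
Qed.

Lemma quotient_cfgP :
  cfg_language quotient_cfg = left_quotient [set [:: a]] (cfg_language G).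
Proof.
apply/seteqP; split=> w.
- move=> /cfg_languageE Sw; exists [:: a] => //; apply/cfg_languageE.
  by apply: quotient_leftmost Sw; exact: mem_head.
- move=> [_ -> /cfg_languageE /leftmost_quotient[y]].
  (* Nothing follows the start symbol, so, nullable or not, its only quotient is its marked copy. *)
  rewrite /= if_same inE => /eqP-> yw; exact/cfg_languageE.
Qed.

End LetterQuotient.

Lemma CFL_letter_quotient (Sigma : finType) (a : Sigma) (L : language Sigma) :
  CFL L -> CFL (left_quotient [set [:: a]] L).
Proof. by move=> [G <-]; exists (quotient_cfg a G); exact: quotient_cfgP. Qed.

(** * Grammar for the union of two context-free languages *)

Section CfgUnion.
Variables (Sigma : finType) (G1 G2 : cfg Sigma).
Let N : finType := option (nonterminal G1 + nonterminal G2)%type.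
Let left (A : nonterminal G1) : N := Some (inl A).
Let right (A : nonterminal G2) : N := Some (inr A).

(** [None] is a fresh start symbol that chooses between disjoint copies of the two grammars. *)
Definition union_cfg : cfg Sigma :=
  @Cfg Sigma N None
    ([:: (None, [:: inl (left (start G1))]);
         (None, [:: inl (right (start G2))])] ++
     ([seq (left p.1, map (relabel left) p.2) | p <- productions G1] ++
      [seq (right p.1, map (relabel right) p.2) | p <- productions G2])).

Lemma left_production A rhs' : (left A, rhs') \in productions union_cfg <->
  exists2 rhs, (A, rhs) \in productions G1 & rhs' = map (relabel left) rhs.
Proof.
rewrite /= !inE /= mem_cat; split.
  case/orP=> [/mapP[[B rhs] Brhs [-> ->]]|/mapP[p _ []] //].
  by exists rhs.
by move=> [rhs Arhs ->]; apply/orP; left; apply/mapP; exists (A, rhs).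
Qed.

Lemma right_production A rhs' : (right A, rhs') \in productions union_cfg <->
  exists2 rhs, (A, rhs) \in productions G2 & rhs' = map (relabel right) rhs.
Proof.
rewrite /= !inE /= mem_cat; split.
  case/orP=> [/mapP[p _ []] //|/mapP[[B rhs] Brhs [-> ->]]].
  by exists rhs.
by move=> [rhs Arhs ->]; apply/orP; right; apply/mapP; exists (A, rhs).
Qed.

Lemma start_production rhs : (None, rhs) \in productions union_cfg <->
  rhs = [:: inl (left (start G1))] \/ rhs = [:: inl (right (start G2))].
Proof.
rewrite mem_cat !inE /=; split=> [|[->|->]]; last 2 first.
- by rewrite eqxx.
- by rewrite eqxx orbT.
case/orP=> [/orP[/eqP[->]|/eqP[->]]|]; [by left|by right|].
by rewrite mem_cat => /orP[/mapP[? _ []]|/mapP[? _ []]].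
Qed.

Lemma union_cfgP :
  cfg_language union_cfg = cfg_language G1 `|` cfg_language G2.
Proof.
have G1E := leftmost_relabel left_production.
have G2E := leftmost_relabel right_production.
apply/seteqP; split=> w.
- move=> /cfg_languageE; move E: [:: _] => x xw.
  case: xw E => // A rhs x' w' Arhs xw [EA Ex]; move: Arhs xw.
  rewrite -EA -Ex cats0 => /start_production[]-> xw; [left|right];
    apply/cfg_languageE.
    exact/(G1E [:: _]).
  exact/(G2E [:: _]).
- case=> /cfg_languageE H; apply/cfg_languageE.
  + apply: (@LeftmostExpand _ union_cfg _ [:: inl (left (start G1))]).
      by apply/start_production; left.
    exact/(G1E [:: inl (start G1)]).
  + apply: (@LeftmostExpand _ union_cfg _ [:: inl (right (start G2))]).
      by apply/start_production; right.
    exact/(G2E [:: inl (start G2)]).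
Qed.

End CfgUnion.

Lemma CFL_setU (Sigma : finType) (K L : language Sigma) :
  CFL K -> CFL L -> CFL (K `|` L).
Proof. by move=> [G <-] [H <-]; exists (union_cfg G H); exact: union_cfgP. Qed.

Lemma CFL_set0 (Sigma : finType) : CFL (set0 : language Sigma).
Proof.
exists (@Cfg Sigma unit tt [::]); apply/seteqP; split=> w // /cfg_languageE.
by move E: [:: _] => x xw; case: xw E.
Qed.

(** * Quotients by finite sets *)

(** Outer induction on an enumeration of [K], with [set0] for the empty one; inner induction on the
    letters of a word, with [L] general because each letter replaces it by its quotient. *)
Lemma left_quotient_finite (Sigma : finType) (F : set (language Sigma)) :
  F set0 -> (forall K L, F K -> F L -> F (K `|` L)) ->
  (forall a L, F L -> F (left_quotient [set [:: a]] L)) ->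
  forall K L, finite_set K -> F L -> F (left_quotient K L).
Proof.
move=> F0 FU Fa K L /finite_seqP[s ->] FL.
elim: s => [|u s IH].
  by rewrite [left_quotient _ _](_ : _ = set0) // -subset0 => w [].
rewrite [left_quotient _ _](_ : _ =
  left_quotient [set u] L `|` left_quotient [set` s] L); last first.
  apply/seteqP; split=> w.
    move=> [v]; rewrite /= inE => /orP[/eqP->|vs] Lvw.
      by left; exists u.
    by right; exists v.
  by move=> [[_ -> ?]|[v /= vs ?]]; [exists u|exists v] => //=;
    rewrite inE ?eqxx ?vs ?orbT.
apply: FU IH; elim: u L FL => [|a u IH] L FL.
  rewrite [left_quotient _ _](_ : _ = L) //.
  by apply/seteqP; split=> w; [move=> [_ ->]|exists [::]].
rewrite [left_quotient _ _](_ : _ =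
  left_quotient [set u] (left_quotient [set [:: a]] L)); first exact/IH/Fa.
apply/seteqP; split=> w.
  by move=> [_ -> ?]; exists u => //; exists [:: a].
by move=> [_ -> [_ -> ?]]; exists (a :: u).
Qed.

(** * Letter quotients in the Boolean closure *)

Lemma BDC_boolean_closed (Sigma : finType) : boolean_closed (@BDC Sigma).
Proof.
split=> [K L HK HL|K L HK HL|L HL] F FP; have [[FU FI FC] _] := FP.
- by apply: FU; [exact: HK|exact: HL].
- by apply: FI; [exact: HK|exact: HL].
- by apply: FC; exact: HL.
Qed.

Lemma BDC_letter_quotient (Sigma : finType) (a : Sigma) (L : language Sigma) :
  BDC L -> BDC (left_quotient [set [:: a]] L).
Proof.
have [BU BI BC] := BDC_boolean_closed Sigma.
(* As a preimage under prepending [a], the quotient by one letter commutes with complement too,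
   which fails for general [K]. *)
have qE (A : language Sigma) :
    left_quotient [set [:: a]] A = [set w | A (a :: w)].
  by apply/seteqP; split=> w; [move=> [_ ->]|exists [:: a]].
(* Minimality of [BDC], applied to the family of languages whose letter quotient is in [BDC]. *)
move=> /(_ [set A | BDC (left_quotient [set [:: a]] A)]); apply; split.
  split=> [A B|A B|A]; rewrite /= !qE; [exact: BU|exact: BI|exact: BC].
move=> A DA F [_]; apply; exact: DCFL_letter_quotient.
Qed.

(** * Unions and letter quotients of poly-context-free languages *)

Lemma PCF_bigcap (Sigma I : finType) (i0 : I) (C : I -> language Sigma) :
  (forall i, CFL (C i)) -> PCF (\bigcap_i C i).
Proof.
(* [PCF] indexes by ['I_n.+1], so [#|I|] is written as a successor, using the element [i0]. *)
move=> CC; have I0 : #|I| = #|I|.-1.+1.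
  by rewrite prednK //; apply/card_gt0P; exists i0.
exists #|I|.-1, (fun k => C (enum_val (cast_ord (esym I0) k))).
split=> [k|]; first exact: CC.
apply/seteqP; split=> w Cw i _; first exact: Cw.
by have := Cw (cast_ord I0 (enum_rank i)) Logic.I; rewrite cast_ordK enum_rankK.
Qed.

Lemma PCF_set0 (Sigma : finType) : PCF (set0 : language Sigma).
Proof.
rewrite [set0](_ : _ = \bigcap_(i : unit) set0).
  by apply: (PCF_bigcap tt) => _; exact: CFL_set0.
by apply/seteqP; split=> w // /(_ tt Logic.I).
Qed.

Lemma PCF_setU (Sigma : finType) (K L : language Sigma) :
  PCF K -> PCF L -> PCF (K `|` L).
Proof.
move=> [m [C [CC ->]]] [n [D [DC ->]]].
rewrite [_ `|` _](_ : _ = \bigcap_(p : 'I_m.+1 * 'I_n.+1) (C p.1 `|` D p.2)).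
  by apply: (PCF_bigcap (ord0, ord0)) => p; exact: CFL_setU.
apply/seteqP; split=> w.
  by move=> [Cw|Dw] p _; [left; exact: Cw|right; exact: Dw].
(* If [w] misses some [C i], the pairs [(i, j)] with this [i] fixed force [w] into every [D j]. *)
move=> CDw; have [Cw|/existsNP[i nCw]] := pselect (forall i, C i w).
  by left=> i _; exact: Cw.
by right=> j _; have [] := CDw (i, j) Logic.I.
Qed.

(** The quotient by a single word commutes with intersections, as the same prefix serves every
    index. *)
Lemma PCF_letter_quotient (Sigma : finType) (a : Sigma) (L : language Sigma) :
  PCF L -> PCF (left_quotient [set [:: a]] L).
Proof.
move=> [n [C [CC ->]]]; exists n, (fun i => left_quotient [set [:: a]] (C i)).
split=> [i|]; first exact: CFL_letter_quotient.
apply/seteqP; split=> w.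
  by move=> [u ua Cuw] i _; exists u => //; exact: Cuw.
by move=> Cw; exists [:: a] => // i _; have [_ ->] := Cw i Logic.I.
Qed.

Theorem proposition2p10 (Sigma : finType) (K L : language Sigma) :
  finite_set K ->
  (BDC L -> BDC (left_quotient K L)) /\ (PCF L -> PCF (left_quotient K L)).
Proof.
move=> Kfin; split=> HL.
  have [BU BI BC] := BDC_boolean_closed Sigma.
  have B0 : BDC (set0 : language Sigma).
    (* The empty language arises as the intersection of [L] with its complement. *)
    by rewrite -(setICr L); apply: BI => //; exact: BC.
  exact: (left_quotient_finite B0 BU (@BDC_letter_quotient Sigma)) Kfin HL.
exact: (left_quotient_finite (@PCF_set0 Sigma) (@PCF_setU Sigma)
  (@PCF_letter_quotient Sigma)) Kfin HL.
Qed.
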